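(* For every integer $k\ge 1$ \begin{align*} L_k&=\frac{1}{2^{k-1}}+\frac{1}{2^{k-1}}\sum_{s=1}^{\lfloor\frac{k}{2}\rfloor}\sum_{m=0}^{k-2s}\binom{k-s-m}{s}\binom{m+s-1}{m}5^s\\ &=\frac{1}{2^{k-1}}\sum_{s=0}^{\lfloor\frac{k}{2}\rfloor}\binom{k}{2s}5^s. \end{align*}
   Context: $\{L_k\}_{k\ge 0}$ is the Lucas sequence: $L_0=2$, $L_1=1$, $L_{k+1}=L_k+L_{k-1}$ for $k\ge 1$. Empty sums are $0$. *)

(* Defs.v *)
From mathcomp Require Import all_boot all_order all_algebra.

Set Implicit Arguments.
Unset Strict Implicit.
Unset Printing Implicit Defensive.

Fixpoint lucas (n : nat) : nat :=
  match n with
  | 0 => 2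
  | m.+1 => match m with
            | 0 => 1
            | p.+1 => lucas m + lucas p
            end
  end.

(* Main.v *)
Require Import Defs.
From mathcomp Require Import all_boot all_order all_algebra.
From mathcomp Require Import zify.

Set Implicit Arguments.
Unset Strict Implicit.
Unset Printing Implicit Defensive.

Import GRing.Theory.
Local Open Scope ring_scope.

(** Both displayed expressions reduce to identities between natural numbers.

    The double sum: after the substitution [i = m + s - 1] the inner sum is
    the convolution of the columns [s - 1] and [s] of Pascal's triangle, up to
    vanishing terms, so it equals ['C(k, 2 * s)] (Vandermonde's identity for
    the upper index, [sum_bin_conv], specialised in [inner_sum_bin]).  The
    isolated summand [1] is the term [s = 0] of the last expression.

    The Lucas number: [\sum_s 'C(k, 2 * s) 5 ^ s] is the rational part [E k] of
    [(1 + sqrt 5) ^ k].  Since [1 + sqrt 5] is a root of [X^2 = 2 X + 4], so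
    [E (k + 2) = 2 E (k + 1) + 4 E k], which is also the recurrence of
    [2 ^ k * lucas k]; comparing initial values, [2 ^ k * lucas k = 2 * E k]
    ([lucas_bisection]). *)

(** Vandermonde's identity for the upper index: the element of rank [a + 1] in
    an [(a + b + 1)]-subset of [{0, ..., n}] splits it into [a] smaller and [b]
    larger elements.  The proof is Pascal's rule in the second factor. *)
Lemma sum_bin_conv (n a b : nat) :
  (\sum_(0 <= i < n.+1) 'C(i, a) * 'C(n - i, b) = 'C(n.+1, (a + b).+1))%N.
Proof.
elim: n b => [|n IHn] b.
  by rewrite big_nat1 subnn !bin0n binS !bin0n addn_eq0; case: a b => [|a] [|b].
rewrite big_nat_recr //= subnn.
case: b => [|b].
  rewrite muln1 addn0 binS -[X in (_ = 'C(n.+1, X.+1) + _)%N]addn0 -IHn.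
  by congr (_ + _)%N; apply: eq_bigr => i _; rewrite !bin0.
rewrite muln0 addn0 addnS binS -{1}addnS -!IHn -big_split /=.
apply: eq_big_nat => i /andP[_ lt_i].
by rewrite subSn // binS mulnDr.
Qed.

Lemma inner_sum_bin (k s : nat) (s_gt0 : (0 < s)%N) (le_2s_k : (2 * s <= k)%N) :
  (\sum_(0 <= m < (k - 2 * s).+1) 'C(k - s - m, s) * 'C(m + s - 1, m)
   = 'C(k, 2 * s))%N.
Proof.
case: s s_gt0 le_2s_k => // t _ le_2s_k.
case: k le_2s_k => [|n] le_2s_k; first lia.
have -> : (2 * t.+1 = (t + t.+1).+1)%N by lia.
rewrite -sum_bin_conv.
(* The terms [i < t] and [i > n - t.+1] of the convolution vanish. *)
rewrite [RHS](@big_cat_nat _ _ _ t) //=; last lia.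
rewrite [X in (_ = X + _)%N]big1_seq ?add0n; last first.
  by move=> i; rewrite mem_index_iota /= => lt_it; rewrite bin_small.
rewrite [RHS](@big_cat_nat _ _ _ (n - t)) //=; [|lia|lia].
rewrite [X in (_ = _ + X)%N]big1_seq ?addn0; last first.
  move=> i; rewrite mem_index_iota /= => /andP[le_i lt_i].
  by rewrite ['C(n - i, _)]bin_small ?muln0 //; lia.
rewrite -[in RHS](add0n t) big_addn.
have -> : (n - t - t = (n.+1 - (t + t.+1).+1).+1)%N by lia.
apply: eq_big_nat => m /andP[_ lt_m].
rewrite mulnC addnS subn1 /= -[in LHS](bin_sub (leq_addr t m)) addKn.
by congr ('C(_, _) * 'C(_, _))%N; lia.
Qed.

(** The coordinates of [(1 + sqrt 5) ^ k] on [1] ([a = 0]) and [sqrt 5]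
    ([a = 1]), once [k < 2 * N].  Decoupling the length [N] of the sum from [k]
    lets one length serve for all the exponents met in a recurrence. *)
Definition bisection (N a k : nat) : nat :=
  (\sum_(0 <= s < N) 'C(k, 2 * s + a) * 5 ^ s)%N.

Lemma bisection_widen (N M a k : nat) :
  (N <= M)%N -> (k < 2 * N + a)%N -> bisection M a k = bisection N a k.
Proof.
move=> le_NM lt_k; rewrite /bisection (@big_cat_nat _ _ _ N) //=.
rewrite [X in (_ + X)%N]big1_seq ?addn0 // => s.
rewrite mem_index_iota /= => /andP[le_s _]; by rewrite bin_small //; lia.
Qed.

Lemma bisection_odd_rec (N k : nat) :
  bisection N 1 k.+1 = (bisection N 0 k + bisection N 1 k)%N.
Proof.
rewrite /bisection -big_split /=; apply: eq_bigr => s _.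
by rewrite addn1 addn0 binS mulnDl addnC.
Qed.

(** Pascal's rule sends the odd column [2 * s - 1] to the even column [2 * s];
    re-indexing it by [s - 1] yields the factor [5], the square of [sqrt 5]. *)
Lemma bisection_even_rec (N k : nat) (lt_k : (k.+1 < 2 * N)%N) :
  bisection N 0 k.+1 = (bisection N 0 k + 5 * bisection N 1 k)%N.
Proof.
case: N lt_k => // N lt_k.
rewrite (@bisection_widen N N.+1 1 k) //; last lia.
rewrite /bisection !(big_nat_recl N) //= !bin0 -addnA; congr (_ + _)%N.
rewrite big_distrr -big_split /=; apply: eq_bigr => s _.
have -> : (2 * s.+1 + 0 = (2 * s + 1).+1)%N by lia.
by rewrite binS mulnDl expnS [in X in (_ + X)%N]mulnCA.
Qed.

Lemma lucas_bisection (N k : nat) (lt_k : (k < 2 * N)%N) :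
  (2 ^ k * lucas k = 2 * bisection N 0 k)%N.
Proof.
have base : (0 < N)%N -> bisection N 0 0 = 1%N /\ bisection N 1 0 = 0%N.
  move=> N_gt0; rewrite (@bisection_widen 1) // (@bisection_widen 0 _ 1) //.
  by rewrite /bisection big_nat1 big_geq.
elim/ltn_ind: k lt_k => -[|[|k]] IHk lt_k.
- by have [-> _] := base ltac:(lia).
- by rewrite bisection_even_rec //; have [-> ->] := base ltac:(lia).
have IH0 := IHk k ltac:(lia) ltac:(lia).
have IH1 := IHk k.+1 ltac:(lia) ltac:(lia).
have E1 := @bisection_even_rec N k ltac:(lia).
have E2 := @bisection_even_rec N k.+1 lt_k.
have O1 := bisection_odd_rec N k.
have -> : lucas k.+2 = (lucas k.+1 + lucas k)%N by [].
rewrite mulnDr expnS -mulnA IH1 !expnS -!mulnA IH0; lia.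
Qed.

Theorem corollary4p11 (k : nat) (hk : (1 <= k)%N) :
  (lucas k)%:R =
    1 / 2%:R ^+ (k - 1)
    + 1 / 2%:R ^+ (k - 1) *
      \sum_(1 <= s < (k %/ 2).+1) \sum_(0 <= m < (k - 2 * s).+1)
        'C(k - s - m, s)%:R * 'C(m + s - 1, m)%:R * 5%:R ^+ s :> rat
  /\
  1 / 2%:R ^+ (k - 1)
    + 1 / 2%:R ^+ (k - 1) *
      \sum_(1 <= s < (k %/ 2).+1) \sum_(0 <= m < (k - 2 * s).+1)
        'C(k - s - m, s)%:R * 'C(m + s - 1, m)%:R * 5%:R ^+ s =
    1 / 2%:R ^+ (k - 1) *
      \sum_(0 <= s < (k %/ 2).+1) 'C(k, 2 * s)%:R * 5%:R ^+ s :> rat.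
Proof.
have sumE : 1 + \sum_(1 <= s < (k %/ 2).+1) \sum_(0 <= m < (k - 2 * s).+1)
      'C(k - s - m, s)%:R * 'C(m + s - 1, m)%:R * 5%:R ^+ s
    = \sum_(0 <= s < (k %/ 2).+1) 'C(k, 2 * s)%:R * 5%:R ^+ s :> rat.
  rewrite [RHS]big_ltn // bin0 mulr1; congr (_ + _).
  apply: eq_big_nat => s /andP[s_gt0 lt_s].
  rewrite -big_distrl -(@inner_sum_bin k s) //=; last lia.
  by rewrite natr_sum; congr (_ * _); apply: eq_bigr => m _; rewrite natrM.
have factor (c x : rat) : c + c * x = c * (1 + x) by rewrite mulrDr mulr1.
rewrite factor sumE; split=> //.
have -> : \sum_(0 <= s < (k %/ 2).+1) 'C(k, 2 * s)%:R * 5%:R ^+ s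
          = (bisection (k %/ 2).+1 0 k)%:R :> rat.
  by rewrite natr_sum; apply: eq_bigr => s _; rewrite addn0 natrM natrX.
have lucasE : (2 ^ (k - 1) * lucas k = bisection (k %/ 2).+1 0 k)%N.
  have := @lucas_bisection (k %/ 2).+1 k ltac:(lia).
  by rewrite -{1}(subnK hk) addn1 expnS -mulnA => /eqP; rewrite eqn_pmul2l // => /eqP.
rewrite -lucasE natrM natrX mul1r mulKf //.
by rewrite expf_neq0 // pnatr_eq0.
Qed.
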